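(* Suppose the battery cycle aging stress function $\Phi$ is convex. Then the offline version of the battery control problem, in which the entire instruction signal $\mathbf r=(r_1,\dots,r_T)$ is given, namely $$\min_{\mathbf c,\mathbf d}\ \tau\sum_{t=1}^T\Big[\theta\big|\eta_c c_t-\tfrac{d_t}{\eta_d}-r_t\big|^+ +\pi\big|r_t-\eta_c c_t+\tfrac{d_t}{\eta_d}\big|^+\Big]+\Big[\sum_{i=1}^{|\mathbf v|}\frac{\Phi(v_i)}2+\sum_{i=1}^{|\mathbf w|}\frac{\Phi(w_i)}2\Big]\cdot B\cdot E$$ subject to, for $t=1,\dots,T$, $$x_t=x_{t-1}+\frac{\tau\eta_c}{E}c_t-\frac{\tau}{\eta_d E}d_t,\qquad \underline x\le x_t\le\overline x,\qquad 0\le c_t\le P,\qquad 0\le d_t\le P,$$ $$(\mathbf v,\mathbf w)=\mathrm{Rainflow}(\mathbf x),$$ is convex in the charge and discharge variables $\mathbf c=(c_1,\dots,c_T)$ and $\mathbf d=(d_1,\dots,d_T)$.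
   Context: Notation: $|a|^+=\max\{a,0\}$. A battery is operated over time steps $t=1,\dots,T$ of duration $\tau>0$; $c_t$ and $d_t$ are the charging and discharging powers, and $x_t$ is the normalized state of charge (SoC) at the end of step $t$, with known initial value $x_0$; $\mathbf x=(x_1,\dots,x_T)\in\mathbb R^T$. The given constants are the energy capacity $E>0$, the power rating $P>0$, the cell replacement price $B>0$, the efficiencies $\eta_c$ and $\eta_d$ (by convention $\eta_c$ lies between 0 and 1 and $\eta_d$ is at least 1), the SoC limits $\underline x<\overline x$, and the nonnegative penalty prices $\theta,\pi$. The instruction $r_t\in[-P,P]$ is positive for charging instructions. The stress function $\Phi$ is a real-valued increasing function of the cycle depth $u\ge 0$; $\Phi(u)$ is the fraction of battery life lost in one cycle of depth $u$. Rainflow: given a finite real sequence (an SoC profile), extract its sequence of local extrema $s_1,s_2,\dots,s_N$ (merging consecutive equal values and keeping the first and last points, so that consecutive differences alternate in sign). Scanning from the start, look for four successive points $s_i,s_{i+1},s_{i+2},s_{i+3}$ of the current sequence with $|s_{i+1}-s_{i+2}|\le|s_i-s_{i+1}|$ and $|s_{i+1}-s_{i+2}|\le|s_{i+2}-s_{i+3}|$. When found, a full cycle of depth $|s_{i+1}-s_{i+2}|$ is extracted, which counts as one charging half cycle and one discharging half cycle of that depth; the points $s_{i+1},s_{i+2}$ are discarded and the remaining parts of the sequence are joined. This is repeated until no such four points remain. In the remaining sequence (the residue), every two consecutive points $s,s'$ form a half cycle of depth $|s-s'|$, charging if $s'>s$ and discharging if $s'<s$. The output $(\mathbf v,\mathbf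 w)$ consists of the vector $\mathbf v$ of depths of all charging half cycles and the vector $\mathbf w$ of depths of all discharging half cycles; $|\mathbf v|,|\mathbf w|$ denote their numbers of entries.
   Formalization: The formal theorem additionally assumes Φ(0)=0 (a cycle of depth 0 costs no battery life); without it the claim fails, e.g. T=2, Φ(u)=1+u, where the aging cost jumps to 0 at x_1=x_2 because Rainflow yields no half cycle there. *)

(* Defs.v *)
From HB Require Import structures.
From mathcomp Require Import all_boot all_order all_algebra.
From mathcomp Require Import boolp classical_sets reals interval_inference convex.

Set Implicit Arguments.
Unset Strict Implicit.
Unset Printing Implicit Defensive.

Import Order.TTheory GRing.Theory Num.Theory.

Local Open Scope classical_set_scope.
Local Open Scope ring_scope.

Section Rainflow.
Context {R : realType}.
Implicit Types (s : seq R).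

Fixpoint merge_equal s : seq R :=
  if s is a :: t then
    if t is b :: _ then if a == b then merge_equal t else a :: merge_equal t
    else s
  else s.

(* p is the point just before s; the last point of s is always kept. *)
Fixpoint local_extrema_after (p : R) s : seq R :=
  if s is q :: t then
    if t is r :: _ then
      if (p < q) && (r < q) || (q < p) && (q < r)
      then q :: local_extrema_after q t
      else local_extrema_after q t
    else s
  else s.

Definition local_extrema s : seq R :=
  if merge_equal s is a :: t then a :: local_extrema_after a t else [::].

(* Some (u, s') : the first four successive points of s satisfying the test
   contain a full cycle of depth u, and s' is s without its two inner points. *)
Fixpoint find_full_cycle s : option (R * seq R) :=
  if s is s0 :: t then
    if t is [:: s1, s2, s3 & s'] then
      if (`|s1 - s2| <= `|s0 - s1|) && (`|s1 - s2| <= `|s2 - s3|)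
      then Some (`|s1 - s2|, [:: s0, s3 & s'])
      else if find_full_cycle t is Some (u, t') then Some (u, s0 :: t') else None
    else None
  else None.

(* Depths of the extracted full cycles, and the residue. Each extraction
   removes two points, so n = size s is enough fuel (extract_full_cycles_done). *)
Fixpoint extract_full_cycles (n : nat) s : seq R * seq R :=
  if n is n'.+1 then
    if find_full_cycle s is Some (u, s') then
      let: (us, res) := extract_full_cycles n' s' in (u :: us, res)
    else ([::], s)
  else ([::], s).

Lemma find_full_cycle_size s u s' :
  find_full_cycle s = Some (u, s') -> size s = (size s').+2.
Proof.
elim: s u s' => [//|s0 t IH] u s'.
case: t IH => [//|s1 [//|s2 [//|s3 t]]] IH; lazy delta [find_full_cycle] iota beta.
rewrite -/(find_full_cycle [:: s1, s2, s3 & t]).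
case: ifP => _; first by case=> _ <-.
by case Et: (find_full_cycle _) => [[v t']|//] [_ <-] /=; rewrite -(IH _ _ Et).
Qed.

Lemma extract_full_cycles_done n s :
  (size s <= n)%N -> find_full_cycle (extract_full_cycles n s).2 = None.
Proof.
elim: n s => [|n IH] s; first by rewrite leqn0 => /nilP ->.
rewrite /=; case E: (find_full_cycle s) => [[u s']|//] lesn.
have: (size s' <= n)%N.
  by move: lesn; rewrite (find_full_cycle_size E) ltnS => /ltnW.
by move/IH; case: extract_full_cycles.
Qed.

(* Consecutive pairs of points. *)
Definition steps s : seq (R * R) := zip s (behead s).

Definition charging_half_cycles s : seq R :=
  [seq `|p.1 - p.2| | p <- steps s & p.1 < p.2].

Definition discharging_half_cycles s : seq R :=
  [seq `|p.1 - p.2| | p <- steps s & p.2 < p.1].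

(* The pair (v, w) of the depths of the charging and discharging half cycles. *)
Definition rainflow (x : seq R) : seq R * seq R :=
  let s := local_extrema x in
  let: (us, res) := extract_full_cycles (size s) s in
  (us ++ charging_half_cycles res, us ++ discharging_half_cycles res).

End Rainflow.

Section BatteryControl.
Context {R : realType} {T : nat}.
Implicit Types (c d r : 'rV[R]_T).

Definition pos_part (a : R) : R := Num.max a 0.

(* The sequence x_1, ..., x_T, whose entry of index t : 'I_T (time t + 1) is
   computed from the previous one, or from x0 (soc_profile_rec). *)
Definition soc_profile (tau E eta_c eta_d x0 : R) c d : seq R :=
  scanl (fun x (t : 'I_T) =>
           x + tau * eta_c / E * c 0 t - tau / (eta_d * E) * d 0 t)
        x0 (enum 'I_T).

Lemma size_soc_profile tau E eta_c eta_d x0 c d :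
  size (soc_profile tau E eta_c eta_d x0 c d) = T.
Proof. by rewrite size_scanl size_enum_ord. Qed.

Lemma soc_profile_rec tau E eta_c eta_d x0 c d (t : 'I_T) :
  let x := x0 :: soc_profile tau E eta_c eta_d x0 c d in
  x`_t.+1 = x`_t + tau * eta_c / E * c 0 t - tau / (eta_d * E) * d 0 t.
Proof.
set f := fun x (t : 'I_T) =>
  x + tau * eta_c / E * c 0 t - tau / (eta_d * E) * d 0 t.
rewrite /= /soc_profile -/f.
have scanl_step (ts : seq 'I_T) (y : R) (k : nat) : (k < size ts)%N ->
    (scanl f y ts)`_k = f (y :: scanl f y ts)`_k (nth t ts k).
  elim: ts y k => [//|a ts IH] y [//|k] /= lt_k.
  by rewrite IH.
by rewrite scanl_step ?size_enum_ord// nth_ord_enum.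
Qed.

Definition feasible (tau E P eta_c eta_d x0 xmin xmax : R) :
    set ('rV[R]_T * 'rV[R]_T) :=
  [set cd | forall t : 'I_T,
    [/\ xmin <= (soc_profile tau E eta_c eta_d x0 cd.1 cd.2)`_t <= xmax,
        0 <= cd.1 0 t <= P & 0 <= cd.2 0 t <= P]].

Definition mismatch_penalty (tau eta_c eta_d theta pi : R) r c d : R :=
  tau * \sum_(t < T)
    (theta * pos_part (eta_c * c 0 t - d 0 t / eta_d - r 0 t)
     + pi * pos_part (r 0 t - eta_c * c 0 t + d 0 t / eta_d)).

(* Rainflow yields no half cycle of depth 0, so a constant profile costs 0 and
   the cost is continuous at it only if Phi 0 = 0. *)
Definition aging_cost (Phi : R -> R) (B E : R) (x : seq R) : R :=
  let: (v, w) := rainflow x in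
  (\sum_(u <- v) Phi u / 2 + \sum_(u <- w) Phi u / 2) * B * E.

Definition objective (Phi : R -> R) (tau E B eta_c eta_d theta pi x0 : R) r
    (cd : 'rV[R]_T * 'rV[R]_T) : R :=
  mismatch_penalty tau eta_c eta_d theta pi r cd.1 cd.2
  + aging_cost Phi B E (soc_profile tau E eta_c eta_d x0 cd.1 cd.2).

End BatteryControl.

(* Main.v *)
Require Import Defs.
From HB Require Import structures.
From mathcomp Require Import all_boot all_order all_algebra.
From mathcomp Require Import boolp classical_sets reals interval_inference convex.
From mathcomp Require Import ring lra.

Set Implicit Arguments.
Unset Strict Implicit.
Unset Printing Implicit Defensive.

Import Order.TTheory GRing.Theory Num.Theory.

Local Open Scope classical_set_scope.
Local Open Scope ring_scope.

(** The key is to replace rainflow counting by a maximum. For a threshold [h],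
    let [hinge h u] be the positive part of [u - h]. The total hinge of the
    half cycles found by rainflow equals the truncated variation of the
    profile at level [h], that is, the maximum of the sums of
    [hinge h `|s' - s|] over the pairs of consecutive points [s], [s'] of a
    subsequence, the subsequence being arbitrary
    ([rainflow_truncated_variation]). For a fixed subsequence such a sum is
    convex in the profile, and a maximum of convex functions is convex.

    A general stress function reduces to hinges: comparing the costs of two
    profiles and of a convex combination of them involves finitely many depths,
    and on a finite set of nonnegative reals a convex nondecreasing [Phi] with
    [Phi 0 = 0] coincides with a nonnegative combination of hinges with
    nonnegative thresholds ([hinge_expansion]).

    The identity for the hinge follows the algorithm. A point lying between its
    two neighbours can be left out without changing the truncated variation
    ([tv_between]), so that only the local extrema matter. Extracting a full
    cycle of depth [u] lowers the truncated variation by exactly [2 hinge h u]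
    ([tv_four_points]). In the residue the differences first grow and then
    shrink, and no subsequence does better than the whole residue
    ([tv_residue]). For the first two facts to hold inside a longer sequence,
    they are proved for the truncated variation [tv h z s] preceded by an
    arbitrary point [z]; as a function of [z], it is a maximum of functions of
    the form [z |-> jump h z q + c] and of the constant [0], and the inequalities
    between its values are checked on these pieces ([tv_piece]).

    The state of charge is affine in the powers and the mismatch penalty is a
    sum of positive parts of affine functions, so the rest is routine. *)

(** * Truncated variation *)

Section TruncatedVariation.
Context {R : realType}.
Variable (h : R).
Hypothesis (h_ge0 : 0 <= h).
Implicit Types (p z a b : R) (s t : seq R).

Definition hinge (u : R) : R := pos_part (u - h).

Definition jump a b : R := hinge `|a - b|.

Definition between a x b : bool := (a <= x <= b) || (b <= x <= a).

Lemma hinge_le u v : u <= v -> hinge u <= hinge v.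
Proof.
by rewrite /hinge /pos_part => uv; rewrite ge_max !le_max lerB// lexx orbT.
Qed.

Lemma jumpC a b : jump a b = jump b a.
Proof. by rewrite /jump distrC. Qed.

Lemma jumpxx a : jump a a = 0.
Proof.
by rewrite /jump /hinge /pos_part subrr normr0 sub0r; apply/max_idPr; rewrite oppr_le0.
Qed.

(** For linear arithmetic: [jump a b] is a maximum of three affine functions. *)
Lemma jump_facts a b :
  [/\ 0 <= jump a b, a - b - h <= jump a b, b - a - h <= jump a b &
      [\/ jump a b = 0, jump a b = a - b - h | jump a b = b - a - h]].
Proof.
rewrite /jump /hinge /pos_part.
case: (ger0P (a - b)) => ab; case: (leP _ 0) => H; split; try lra.
- by constructor 1.
- by constructor 2.
- by constructor 1.
- by constructor 3; rewrite opprB.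
Qed.


(** The truncated variation at level [h] of the sequence [z :: s]: the largest
    sum of jumps along a subsequence starting at [z]. As jumps are nonnegative,
    forcing the subsequence to start at the first point costs nothing. *)
Fixpoint tv z s : R :=
  if s is a :: t then Num.max (tv z t) (jump z a + tv a t) else 0.

Lemma tv_cons z a t : tv z (a :: t) = Num.max (tv z t) (jump z a + tv a t).
Proof. by []. Qed.

Lemma tv_cons_ge z a t : tv z t <= tv z (a :: t).
Proof. by rewrite /= le_max lexx. Qed.

Lemma tv_step_ge z a t : jump z a + tv a t <= tv z (a :: t).
Proof. by rewrite /= le_max lexx orbT. Qed.

Lemma tv_cons_le z a t (C : R) :
  (tv z (a :: t) <= C) = (tv z t <= C) && (jump z a + tv a t <= C).
Proof. by rewrite tv_cons ge_max. Qed.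

Lemma tv_ge0 z s : 0 <= tv z s.
Proof. by elim: s => //= a s IH; rewrite le_max IH. Qed.

Lemma tv_opp z s : tv (- z) [seq - a | a <- s] = tv z s.
Proof.
elim: s z => //= a s IH z.
by rewrite !IH /jump -opprD normrN.
Qed.

Lemma tv_head z t : tv z (z :: t) = tv z t.
Proof. by rewrite /= jumpxx add0r maxxx. Qed.

Lemma tv_shift z s s' (C : R) :
  (forall p, tv p s = tv p s' + C) ->
  forall p, tv p (z :: s) = tv p (z :: s') + C.
Proof. by move=> E p; rewrite /= !E addrA -addr_maxl. Qed.

Lemma tv_lipschitz z p s : tv z s <= `|z - p| + tv p s.
Proof.
elim: s => [|a s IH]; first by rewrite /= addr0.
have := tv_cons_ge p a s; have := tv_step_ge p a s.
rewrite [X in X <= `|_| + _]tv_cons ge_max.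
case: (jump_facts z a) => _ _ _; case: (jump_facts p a) => ? ? ? _ J ? ?.
have := ler_norm (z - p); have := ler_norm (p - z); rewrite distrC => ? ?.
by apply/andP; split; [lra | case: J => ->; lra].
Qed.

(** Each value of [tv] in its first argument is attained by the constant [0] or
    by a function [z |-> jump z q + c] that stays below [tv] everywhere: take for
    [q] the second point of an optimal subsequence. Inequalities that bound a
    value of [tv] by other values of [tv] can thus be checked on these pieces. *)
Lemma tv_piece z0 s :
  tv z0 s = 0 \/ exists q c,
    tv z0 s = jump z0 q + c /\ forall z, jump z q + c <= tv z s.
Proof.
elim: s => [|a s IH] /=; first by left.
case: leP => _.
  by right; exists a, (tv a s); split=> // z; rewrite le_max lexx orbT.
case: IH => [->|[q [c [-> H]]]]; first by left.
by right; exists q, c; split=> // z; rewrite le_max H.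
Qed.

(** The function [a |-> jump p a + tv a s] is convex, so on a segment it is at
    most its value at one of the ends. *)
Lemma tv_quasiconvex p z a b s :
  between z a b ->
  jump p a + tv a s <= Num.max (jump p z + tv z s) (jump p b + tv b s).
Proof.
move=> zab; rewrite leNgt gt_max; apply/negP => /andP[].
case: (jump_facts p z) => + + + _; case: (jump_facts p b) => + + + _.
case: (jump_facts p a) => _ _ _.
case: (tv_piece a s) => [->|[q [c [-> H]]]].
  have := tv_ge0 z s; have := tv_ge0 b s.
  by case/orP: zab => /andP[? ?] ? ? [] -> *; lra.
have := H z; have := H b.
case: (jump_facts z q) => + + + _; case: (jump_facts b q) => + + + _.
case: (jump_facts a q) => _ _ _.
by case/orP: zab => /andP[? ?] [] -> ? ? ? ? ? ? ? ? [] -> *; lra.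
Qed.

Lemma tv_between p z a b t :
  between z a b ->
  tv p [:: z, a, b & t] = tv p [:: z, b & t].
Proof.
move=> zab; have Hq x := tv_quasiconvex x (b :: t) zab.
have E x : jump x b + tv b (b :: t) <= tv x (b :: t).
  by rewrite tv_head tv_step_ge.
have Ez : tv z [:: a, b & t] = tv z (b :: t).
  apply/max_idPl; have := Hq z; rewrite jumpxx add0r.
  by move/le_trans; apply; rewrite ge_max lexx E.
rewrite [LHS]tv_cons [RHS]tv_cons Ez [in LHS]tv_cons -maxA.
rewrite [Num.max (jump p a + _) _]maxC maxA; apply/max_idPl.
by apply: le_trans (Hq p) _; rewrite ge_max; apply/andP; split;
  rewrite le_max; apply/orP; [right | left].
Qed.

(** If an optimal subsequence from [z] first jumps above [w], then jumping there
    directly from [p] instead of passing through [w] loses at most [jump z w];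
    otherwise it is the start from [w] instead of [z] that loses at most that. *)
Lemma tv_shortcut p z w s : p <= z <= w ->
  jump p w + tv z s <=
    Num.max (tv p s) (jump p w + tv w s) + jump z w.
Proof.
move=> /andP[pz zw]; rewrite leNgt addr_maxl gt_max; apply/negP => /andP[].
case: (jump_facts p w) => + + + _; case: (jump_facts z w) => + + + _.
case: (jump_facts p w) => _ _ _ J.
case: (tv_piece z s) => [->|[q [c [-> H]]]].
  have := tv_ge0 p s; have := tv_ge0 w s.
  by move: J => [] -> *; lra.
have := H p; have := H w.
case: (jump_facts p q) => + + + _; case: (jump_facts w q) => + + + _.
case: (jump_facts z q) => _ _ _.
by move: J => [] -> [] -> *; lra.
Qed.

(** * Extracting a full cycle *)

Lemma tv_detour x (s0 y s3 : R) t : s0 <= y <= s3 ->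
  jump x y + tv y (s3 :: t) <= tv x [:: s0, s3 & t].
Proof.
move=> ysl; apply: le_trans (tv_quasiconvex x _ (_ : (s0 <= y <= s3) || _)) _.
  by rewrite ysl.
rewrite ge_max tv_step_ge andTb; apply: le_trans (tv_cons_ge _ _ _).
by rewrite tv_head tv_step_ge.
Qed.

(** The part of the upper bound in which both inner points are visited: going
    to the peak [s1] and resuming at the valley [s2] gains at most one jump
    between them over what is possible without these two points. *)
Lemma tv_skip_peak x (s0 s1 s2 s3 : R) t : s0 <= s2 -> s2 <= s1 -> s1 <= s3 ->
  jump x s1 + tv s2 (s3 :: t) <= tv x [:: s0, s3 & t] + jump s1 s2.
Proof.
move=> le02 le21 le13.
have F2 : jump x s2 + tv s2 (s3 :: t) <= tv x [:: s0, s3 & t].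
  by apply: tv_detour; rewrite le02 (le_trans le21 le13).
have F1 : jump x s1 + tv s1 (s3 :: t) <= tv x [:: s0, s3 & t].
  by apply: tv_detour; rewrite (le_trans le02 le21) le13.
case: (jump_facts s1 s2) => ? ? ? _; case: (jump_facts x s2) => ? ? ? _.
have [lx2|lt2x] := leP x s2; last first.
  by case: (jump_facts x s1) => _ _ _ []->; lra.
have /(tv_shortcut (s3 :: t)) : x <= s2 <= s1 by rewrite lx2.
rewrite (jumpC s2) => /le_trans; apply.
by rewrite lerD2r ge_max F1 tv_cons_ge.
Qed.

Lemma tv_four_points_le x (s0 s1 s2 s3 : R) t :
  s0 <= s2 -> s2 <= s1 -> s1 <= s3 ->
  tv x [:: s0, s1, s2, s3 & t] <=
  tv x [:: s0, s3 & t] + (jump s1 s2 + jump s1 s2).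
Proof.
move=> le02 le21 le13.
have H y : tv y [:: s1, s2, s3 & t] <=
           tv y [:: s0, s3 & t] + (jump s1 s2 + jump s1 s2).
  have F2 : jump y s2 + tv s2 (s3 :: t) <= tv y [:: s0, s3 & t].
    by apply: tv_detour; rewrite le02 (le_trans le21 le13).
  have F1 : jump y s1 + tv s1 (s3 :: t) <= tv y [:: s0, s3 & t].
    by apply: tv_detour; rewrite (le_trans le02 le21) le13.
  have F0 := tv_cons_ge y s0 (s3 :: t).
  have Fs := tv_skip_peak y t le02 le21 le13.
  have [J _ _ _] := jump_facts s1 s2.
  rewrite (tv_cons_le y s1) (tv_cons_le y s2) -[X in _ && X]lerBrDl.
  rewrite (tv_cons_le s1 s2).
  by apply/andP; split; apply/andP; split; lra.
rewrite (tv_cons_le x s0) H andTb.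
have := H s0; rewrite tv_head; have := tv_step_ge x s0 (s3 :: t).
by move=> ? ?; lra.
Qed.

(** When the depth [s1 - s2] is at most [h], the added term is zero. Otherwise
    the three jumps between successive points among the four are affine, and a
    subsequence avoiding [s1] and [s2] is improved by visiting more of the four
    points; which ones depends on the position of the preceding point. *)
Lemma tv_four_points_ge x (s0 s1 s2 s3 : R) t :
  s0 <= s2 -> s2 <= s1 -> s1 <= s3 ->
  tv x [:: s0, s3 & t] + (jump s1 s2 + jump s1 s2) <=
  tv x [:: s0, s1, s2, s3 & t].
Proof.
move=> le02 le21 le13; have h0 := h_ge0.
have Kr y : tv y (s3 :: t) <= tv y [:: s1, s2, s3 & t].
  exact: le_trans (tv_cons_ge _ _ _) (tv_cons_ge _ _ _).
have [leJ|gth] := leP (s1 - s2) h.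
  have -> : jump s1 s2 = 0 by case: (jump_facts s1 s2) => ? ? ? [] *; lra.
  rewrite !addr0 (tv_cons_le x s0) (le_trans (Kr x) (tv_cons_ge _ _ _)) andTb.
  by apply: le_trans (tv_step_ge _ _ _); rewrite lerD2l Kr.
have -> : jump s1 s2 = s1 - s2 - h by case: (jump_facts s1 s2) => ? ? ? [] *; lra.
have J01 : s1 - s0 - h <= jump s0 s1 by case: (jump_facts s0 s1).
have J12 : s1 - s2 - h <= jump s1 s2 by case: (jump_facts s1 s2).
have J23 : s3 - s2 - h <= jump s2 s3 by case: (jump_facts s2 s3).
have A4 y := tv_cons_ge y s0 [:: s1, s2, s3 & t].
have A3 y := tv_cons_ge y s1 [:: s2, s3 & t].
have A2 y := tv_cons_ge y s2 (s3 :: t).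
have A1 y := tv_cons_ge y s3 t.
have B4 y := tv_step_ge y s0 [:: s1, s2, s3 & t].
have B3 y := tv_step_ge y s1 [:: s2, s3 & t].
have B2 y := tv_step_ge y s2 (s3 :: t).
have B1 y := tv_step_ge y s3 t.
(* Starting below the valley, visiting the peak and then the valley gains two
   jumps between them. *)
have low y : y <= s2 ->
    tv y t + (s1 - s2 - h + (s1 - s2 - h)) <= tv y [:: s1, s2, s3 & t].
  move=> y2; have := B3 y; have := B2 s1; have := A1 s2.
  have := tv_lipschitz y s2 t; rewrite ler0_norm ?subr_le0//.
  by case: (jump_facts y s1) => *; lra.
(* A subsequence that skips all four points gains two jumps by visiting some of
   them. *)
have G4 : tv x t + (s1 - s2 - h + (s1 - s2 - h)) <= tv x [:: s0, s1, s2, s3 & t].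
  have [/low|lt2x] := leP x s2; first by move/le_trans; apply.
  have [le1x|ltx1] := leP s1 x.
    have := A4 x; have := A3 x; have := B2 x; have := B1 s2.
    case: (jump_facts x s2) => *.
    have := tv_lipschitz x s3 t.
    by case: (ger0P (x - s3)) => *; lra.
  have : (s2 <= x <= s3) || (s3 <= x <= s2) by apply/orP; left; lra.
  move/(tv_quasiconvex x t); rewrite jumpxx add0r le_max => /orP[] Gx.
    have := B4 x; have := B3 s0; have := B2 s1; have := A1 s2.
    case: (jump_facts x s0) => ? ? ? _.
    by case: (jump_facts x s2) => ? ? ? [] *; lra.
  have := B4 x; have := B3 s0; have := B2 s1; have := B1 s2.
  case: (jump_facts x s0) => ? ? ? _.
  by case: (jump_facts x s3) => ? ? ? [] *; lra.
rewrite -lerBrDr (tv_cons_le x s0) (tv_cons_le x s3) lerBrDr G4 andTb.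
rewrite -[X in _ && X]lerBrDl (tv_cons_le s0 s3).
apply/andP; split; last (apply/andP; split).
- have [lex2|lt2x] := leP x s2.
    have := A4 x; have := B3 x; have := B2 s1; have := B1 s2.
    case: (jump_facts x s1) => ? ? ? _.
    by case: (jump_facts x s3) => ? ? ? [] *; lra.
  have := B4 x; have := B3 s0; have := B2 s1; have := B1 s2.
  case: (jump_facts x s0) => ? ? ? _.
  by case: (jump_facts x s3) => ? ? ? [] *; lra.
- by have := low _ le02; have := B4 x; lra.
- have := B4 x; have := B3 s0; have := B2 s1; have := B1 s2.
  by case: (jump_facts s0 s3) => ? ? ? [] *; lra.
Qed.

Lemma tv_four_points x (s0 s1 s2 s3 : R) t :
  [&& s0 <= s2, s2 <= s1 & s1 <= s3] || [&& s3 <= s1, s1 <= s2 & s2 <= s0] ->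
  tv x [:: s0, s1, s2, s3 & t] =
  tv x [:: s0, s3 & t] + (jump s1 s2 + jump s1 s2).
Proof.
have up y r0 r1 r2 r3 u : r0 <= r2 -> r2 <= r1 -> r1 <= r3 ->
    tv y [:: r0, r1, r2, r3 & u] =
    tv y [:: r0, r3 & u] + (jump r1 r2 + jump r1 r2).
  by move=> *; apply/le_anti; rewrite tv_four_points_le ?tv_four_points_ge.
case/orP => /and3P[? ? ?]; first exact: up.
rewrite -[LHS]tv_opp -[tv x (s0 :: _)]tv_opp !map_cons up ?lerN2//.
by rewrite /jump -opprD normrN.
Qed.

End TruncatedVariation.

(** * Local extrema *)

Section LocalExtrema.
Context {R : realType}.
Variable (h : R).
Hypothesis (h_ge0 : 0 <= h).

(** The sequence [k :: s] alternates strictly, going up first if [up] holds. *)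
Fixpoint zigzag (up : bool) (k : R) (s : seq R) : bool :=
  if s is q :: t then (if up then k < q else q < k) && zigzag (~~ up) q t
  else true.

Lemma zigzag_cons up k q t :
  zigzag up k (q :: t) = (if up then k < q else q < k) && zigzag (~~ up) q t.
Proof. by []. Qed.

Lemma tv_merge_equal (a : R) s : exists2 m,
  merge_equal (a :: s) = a :: m &
  path (fun b c => b != c) a m /\ forall p, tv h p (a :: s) = tv h p (a :: m).
Proof.
elim: s a => [|b s IH] a; first by exists [::].
have [m Em [pm tvm]] := IH b.
have -> : merge_equal [:: a, b & s] =
    if a == b then merge_equal (b :: s) else a :: merge_equal (b :: s) by [].
have [->|neab] := eqVneq a b; rewrite Em.
  exists m => //; split=> // p.
  rewrite -tvm tv_cons tv_head // tv_cons.
  by apply/max_idPl; rewrite le_max lexx orbT.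
exists (b :: m) => //; split=> [|p]; first by rewrite /= neab.
by rewrite !(tv_cons _ _ a) !tvm.
Qed.

Lemma local_extrema_after_cons (p q r : R) t :
  local_extrema_after p [:: q, r & t] =
  if (p < q) && (r < q) || (q < p) && (q < r)
  then q :: local_extrema_after q (r :: t) else local_extrema_after q (r :: t).
Proof. by []. Qed.

(** The induction carries, besides the previous point [p], the last point [k]
    that was kept: the profile is monotone from [k] through [p] to [q], so that
    dropping [q] when it is not an extremum is an instance of [tv_between]. *)
Lemma tv_local_extrema_after (k p q : R) t :
  path (fun b c => b != c) q t ->
  (k <= p < q -> zigzag true k (local_extrema_after p (q :: t))) /\
  (q < p <= k -> zigzag false k (local_extrema_after p (q :: t))) /\
  ((k <= p < q) || (q < p <= k) -> forall x,
     tv h x (k :: local_extrema_after p (q :: t)) = tv h x [:: k, q & t]).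
Proof.
elim: t k p q => [|r t IH] k p q.
  move=> _; split; [|split=> //] => /=.
    by move=> /andP[kp pq]; rewrite (le_lt_trans kp pq).
  by move=> /andP[qp pk]; rewrite (lt_le_trans qp pk).
case/andP=> neqr pt.
have {IH}IH k' p' := IH k' p' r pt.
rewrite local_extrema_after_cons.
have keep : q < r \/ r < q by apply/orP; rewrite -neq_lt.
have [] := IH k q; have [] := IH q q.
move=> upq [dnq tvq] upk [dnk tvk].
split; [|split].
- move=> /andP[kp pq]; rewrite pq (lt_gtF pq) orbF andTb.
  case: keep => qr; first by rewrite (lt_gtF qr) upk ?(le_trans kp (ltW pq)).
  by rewrite qr zigzag_cons (le_lt_trans kp pq) dnq// qr lexx.
- move=> /andP[qp pk]; rewrite qp (lt_gtF qp) orFb.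
  case: keep => qr; last by rewrite (lt_gtF qr) dnk ?qr ?(le_trans (ltW qp) pk).
  by rewrite qr zigzag_cons (lt_le_trans qp pk) upq// qr lexx.
- move=> H x.
  case: ifP => E.
    have qq : (q <= q < r) || (r < q <= q) by rewrite lexx andbT; apply/orP.
    by rewrite !(tv_cons _ _ k) !(tvq qq).
  have [kqr|rqk] : (k <= q < r) \/ (r < q <= k).
    case/orP: H => /andP[H1 H2]; case: keep => qr.
    - by left; rewrite qr (le_trans H1 (ltW H2)).
    - by move: E; rewrite H2 qr.
    - by move: E; rewrite H1 qr orbT.
    - by right; rewrite qr (le_trans (ltW H1) H2).
  by rewrite tvk ?kqr// tv_between// /between; case/andP: kqr => -> /ltW ->.
  rewrite tvk ?rqk ?orbT// tv_between// /between.
  by case/andP: rqk => /ltW -> ->; rewrite orbT.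
Qed.

Lemma tv_local_extrema (a : R) s : exists2 m,
  local_extrema (a :: s) = a :: m &
  (exists up, zigzag up a m) /\ tv h a s = tv h a m.
Proof.
rewrite /local_extrema; have [m -> [pm tvm]] := tv_merge_equal a s.
exists (local_extrema_after a m) => //.
have {tvm} tvm : tv h a s = tv h a m by have := tvm a; rewrite !tv_head.
case: m pm tvm => [|q t] /=; first by split=> //; exists true.
move=> /andP[neaq pt] tvm.
have [up [dn tvl]] := tv_local_extrema_after a a pt.
have dir : (a <= a < q) || (q < a <= a) by rewrite lexx andbT -neq_lt.
split; first by case/orP: dir => [/up|/dn]; eexists; eassumption.
by have := tvl dir a; rewrite !(@tv_head _ h) // -/(tv h a (q :: t)) tvm.
Qed.

End LocalExtrema.

(** * Rainflow counting computes the truncated variation *)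

Section RainflowTruncatedVariation.
Context {R : realType}.
Variable (h : R).
Hypothesis (h_ge0 : 0 <= h).

Lemma zigzag_contracting up (k q r : R) t : zigzag up k [:: q, r & t] ->
  `|q - r| <= `|k - q| -> between k r q.
Proof.
case: up => /= /and3P[a b _].
  rewrite (gtr0_norm (_ : 0 < q - r)) ?subr_gt0//.
  rewrite (ltr0_norm (_ : k - q < 0)) ?subr_lt0// => ?.
  by apply/orP; left; apply/andP; split; lra.
rewrite (ltr0_norm (_ : q - r < 0)) ?subr_lt0//.
rewrite (gtr0_norm (_ : 0 < k - q)) ?subr_gt0// => ?.
by apply/orP; right; apply/andP; split; lra.
Qed.

Lemma zigzag_expanding up (k q r : R) t : zigzag up k [:: q, r & t] ->
  `|k - q| <= `|q - r| -> between q k r.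
Proof.
case: up => /= /and3P[a b _].
  rewrite (gtr0_norm (_ : 0 < q - r)) ?subr_gt0//.
  rewrite (ltr0_norm (_ : k - q < 0)) ?subr_lt0// => ?.
  by apply/orP; right; apply/andP; split; lra.
rewrite (ltr0_norm (_ : q - r < 0)) ?subr_lt0//.
rewrite (gtr0_norm (_ : 0 < k - q)) ?subr_gt0// => ?.
by apply/orP; left; apply/andP; split; lra.
Qed.

Lemma zigzag_full_cycle up (k q r r' : R) t : zigzag up k [:: q, r, r' & t] ->
  `|q - r| <= `|k - q| -> `|q - r| <= `|r - r'| ->
  if up then [&& k <= r, r < q & q <= r'] else [&& r' <= q, q < r & r <= k].
Proof.
move=> zz le1 le2; have := zigzag_contracting zz le1.
case/andP: zz => kq zz; have := zigzag_expanding zz le2.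
by case: up kq zz => kq /and3P[qr rr' _] /orP[] /andP[? ?] /orP[] /andP[? ?];
  apply/and3P; split; move: kq qr rr' => /= *; lra.
Qed.

Lemma find_full_cycle_cons (s0 s1 s2 s3 : R) t :
  find_full_cycle [:: s0, s1, s2, s3 & t] =
  if (`|s1 - s2| <= `|s0 - s1|) && (`|s1 - s2| <= `|s2 - s3|)
  then Some (`|s1 - s2|, [:: s0, s3 & t])
  else if find_full_cycle [:: s1, s2, s3 & t] is Some (u, t')
       then Some (u, s0 :: t') else None.
Proof. by []. Qed.

Lemma tv_find_full_cycle up (k : R) s u s' : zigzag up k s ->
  find_full_cycle (k :: s) = Some (u, s') ->
  exists2 s'', s' = k :: s'' & zigzag up k s'' /\
    forall p, tv h p (k :: s) = tv h p s' + (hinge h u + hinge h u).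
Proof.
elim: s up k u s' => [//|s1 t IH] up k u s' zz.
case: t IH zz => [//|s2 [//|s3 t]] IH zz.
rewrite find_full_cycle_cons; case: ifP => [/andP[le1 le2] [<- <-]|_].
  have chain := zigzag_full_cycle zz le1 le2.
  exists (s3 :: t) => //; split.
    move: zz chain; rewrite !zigzag_cons negbK => /and4P[_ _ _ ->].
    by rewrite andbT; case: (up) => /and3P[? ? ?]; lra.
  move=> p; apply: tv_four_points => //; apply/orP.
  by case: (up) chain => /and3P[? ? ?]; [left | right]; apply/and3P; split; lra.
case E: (find_full_cycle _) => [[v t']|//] [<- <-].
case/andP: zz => ks1 zz.
have [t'' Et' [zz' tvE]] := IH _ _ _ _ zz E.
exists t'; rewrite ?Et' //; split; first by rewrite zigzag_cons ks1 zz'.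
by rewrite -Et'; apply: tv_shift.
Qed.

Lemma extract_full_cyclesS n (s : seq R) :
  extract_full_cycles n.+1 s =
  if find_full_cycle s is Some (u, s') then
    let: (us, res) := extract_full_cycles n s' in (u :: us, res)
  else ([::], s).
Proof. by []. Qed.

Lemma tv_extract_full_cycles n up (k : R) s : zigzag up k s ->
  exists2 s', (extract_full_cycles n (k :: s)).2 = k :: s' &
    zigzag up k s' /\
    forall p, tv h p (k :: s) = tv h p (k :: s') +
      \sum_(u <- (extract_full_cycles n (k :: s)).1) (hinge h u + hinge h u).
Proof.
elim: n s => [|n IH] s zz.
  by exists s => //; split=> // p; rewrite big_nil addr0.
rewrite extract_full_cyclesS; case E: (find_full_cycle _) => [[u s']|]; last first.
  by exists s => //; split=> // p; rewrite big_nil addr0.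
have [s'' Es' [zz' tvE]] := tv_find_full_cycle zz E.
have [r] := IH _ zz'; rewrite -Es'.
case: (extract_full_cycles n s') => us res Er [zr tvr].
exists r; first exact: Er.
split=> // p.
by rewrite tvE tvr big_cons addrAC -addrA.
Qed.

(** Without a full cycle, a difference that does not exceed the previous one is
    larger than the next one; hence the differences keep shrinking, and the rest
    of the sequence stays between its first two points. *)
Lemma residue_between up (k q r : R) t : zigzag up k [:: q, r & t] ->
  `|q - r| <= `|k - q| -> find_full_cycle [:: k, q, r & t] = None ->
  {in r :: t, forall x, between k x q}.
Proof.
elim: t up k q r => [|r' t IH] up k q r zz le_qr.
  by move=> _ x; rewrite inE => /eqP ->; exact: zigzag_contracting zz le_qr.
rewrite find_full_cycle_cons le_qr andTb; case: ifPn => //.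
rewrite -ltNge => lt_rr'; case E: (find_full_cycle _) => [[? ?]|] // _ x.
have hr := zigzag_contracting zz le_qr.
case/andP: zz => _ zz; have hull := IH _ _ _ _ zz (ltW lt_rr') E.
rewrite inE => /predU1P[->//|/hull].
move=> H; apply/orP; move: H hr => /orP[] /andP[? ?] /orP[] /andP[? ?];
  by [left; apply/andP; split; lra | right; apply/andP; split; lra].
Qed.

Lemma tv_dominated (z w M : R) t : 0 <= M -> {in t, forall x, jump h z x <= M} ->
  tv h z t <= M + tv h w t.
Proof.
move=> M0; elim: t => [|x t IH] le_M; first by rewrite addr0.
rewrite tv_cons_le; apply/andP; split.
  apply: le_trans (IH _) _; last by rewrite lerD2l tv_cons_ge.
  by move=> y yt; rewrite le_M// inE yt orbT.
apply: lerD; first by rewrite le_M ?mem_head.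
apply: le_trans (tv_step_ge _ _ _ _).
by rewrite lerDr; case: (jump_facts h w x).
Qed.

(** The whole residue is optimal: skipping the second point [q] never helps. As
    long as the differences grow, [k] lies between [q] and [r], and convexity
    applies; once they shrink, every jump from [k] to a later point is at most
    the jump from [k] to [q]. *)
Lemma tv_residue up (k : R) s : zigzag up k s ->
  find_full_cycle (k :: s) = None ->
  tv h k s = \sum_(p <- steps (k :: s)) jump h p.1 p.2.
Proof.
elim: s up k => [|q t IH] up k zz Ek; first by rewrite big_nil.
have -> : steps [:: k, q & t] = (k, q) :: steps (q :: t) by [].
have [J0 _ _ _] := jump_facts h k q.
rewrite big_cons tv_cons.
case/andP: (zz) => kq zz'; rewrite -(IH _ _ zz'); last first.
  case: t Ek {IH zz zz'} => [//|r [//|r' t]]; rewrite find_full_cycle_cons.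
  by case: ifP => // _; case: (find_full_cycle _) => [[]|].
apply/max_idPr.
case: t zz {zz'} Ek {IH} => [|r t] zz Ek; first by rewrite addr0.
have [le_kq|/ltW le_qr] := leP `|k - q| `|q - r|; last first.
  have hull := residue_between zz le_qr Ek.
  apply: tv_dominated => [//|x /hull xh].
  apply: hinge_le; move: xh => /orP[] /andP[? ?].
    by rewrite !ler0_norm; lra.
  by rewrite !ger0_norm; lra.
have hk := zigzag_expanding zz le_kq.
have := tv_quasiconvex h k (r :: t) hk; rewrite jumpxx// add0r.
move/le_trans; apply; rewrite ge_max lexx andTb.
apply: (@le_trans _ _ (jump h q r + tv h r t)).
  rewrite tv_head// lerD2r hinge_le//.
  by case/orP: hk => /andP[? ?]; [rewrite !ler0_norm|rewrite !ger0_norm]; lra.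
by apply: le_trans (tv_step_ge _ _ _ _) _; rewrite lerDr.
Qed.

Lemma sum_half_cycles (s : seq R) :
  \sum_(p <- steps s) jump h p.1 p.2 =
  \sum_(u <- charging_half_cycles s) hinge h u +
  \sum_(u <- discharging_half_cycles s) hinge h u.
Proof.
rewrite !big_map !big_filter [X in _ = X + _]big_mkcond [X in _ = _ + X]big_mkcond.
rewrite -big_split; apply: eq_bigr => -[a b] _ /=.
by case: (ltgtP a b) => [||->]; rewrite ?addr0 ?add0r// jumpxx.
Qed.

Definition depths (x : seq R) : seq R := (rainflow x).1 ++ (rainflow x).2.

Lemma rainflow_truncated_variation (a : R) s :
  \sum_(u <- depths (a :: s)) hinge h u = tv h a s.
Proof.
rewrite /depths /rainflow; have [m Em [[up zz] ->]] := tv_local_extrema h_ge0 a s.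
rewrite Em; have := extract_full_cycles_done (leqnn (size (a :: m))).
have [m' ] := tv_extract_full_cycles (size (a :: m)) zz.
case: (extract_full_cycles _ _) => us res Er [zz' tvE] done.
have {}Er : res = a :: m' by [].
rewrite {}Er in done *.
have := tvE a; rewrite !tv_head// => ->.
rewrite (tv_residue zz' done) sum_half_cycles !big_cat big_split /=.
lra.
Qed.

End RainflowTruncatedVariation.

(** * Convex functions as combinations of hinges *)

Section HingeExpansion.
Context {R : realType}.
Implicit Types (Phi : R -> R) (D : seq R).

Lemma convex_function_chord Phi (a b u : R) :
  convex_function (E := R^o) [set u : R | 0 <= u] Phi ->
  0 <= a -> a < b -> b < u ->
  (Phi b - Phi a) / (b - a) <= (Phi u - Phi b) / (u - b).
Proof.
move=> cvx a0 ab bu.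
have au : 0 < u - a by lra.
have l0 : 0 <= (u - b) / (u - a) by apply: divr_ge0; lra.
have l1 : (u - b) / (u - a) <= 1 by rewrite ler_pdivrMr// mul1r; lra.
have aS : a \in [set u : R | 0 <= u] by rewrite inE.
have uS : u \in [set u : R | 0 <= u] by rewrite inE /=; lra.
set l := (u - b) / (u - a) in l0 l1.
have := cvx (Itv01 l0 l1) a u aS uS.
rewrite -[leLHS]/(Phi (l * a + (1 - l) * u)).
rewrite -[leRHS]/(l * Phi a + (1 - l) * Phi u).
have lE : l * (u - a) = u - b by rewrite /l divfK ?gt_eqF.
have -> : l * a + (1 - l) * u = b by rewrite -[RHS](subKr u) -lE; ring.
rewrite -(ler_pM2r au) => H.
have E : (l * Phi a + (1 - l) * Phi u) * (u - a) =
         (u - b) * Phi a + (b - a) * Phi u.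
  have -> : b - a = (u - a) - l * (u - a) by rewrite lE; ring.
  by rewrite -lE; ring.
move: H; rewrite E => H.
rewrite ler_pdivrMr ?subr_gt0// mulrAC ler_pdivlMr ?subr_gt0//.
lra.
Qed.

(** The thresholds are [a] and the points of [D] but the last one. Each weight
    is the increase of the slope of the interpolating function at its threshold,
    where [m] is the slope to the left of [a]. *)
Lemma hinge_expansion_from Phi (a m : R) D :
  convex_function (E := R^o) [set u : R | 0 <= u] Phi ->
  0 <= a -> path <%R a D -> {in D, forall u, m <= (Phi u - Phi a) / (u - a)} ->
  exists2 L : seq (R * R),
    {in L, forall w, 0 <= w.1 /\ a <= w.2} &
    {in a :: D, forall u,
       Phi u = Phi a + m * (u - a) + \sum_(w <- L) w.1 * hinge w.2 u}.
Proof.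
move=> cvx; elim: D a m => [|b D IH] a m a0.
  move=> _ _; exists [::] => // u; rewrite inE => /eqP ->.
  by rewrite big_nil subrr mulr0 !addr0.
move=> /andP[ab pD] slope.
set m' := (Phi b - Phi a) / (b - a).
have mm' : m <= m' by rewrite slope ?mem_head.
have aD : {in D, forall u, b < u}.
  have : path <%R b D := pD.
  by rewrite lt_path_sortedE => /andP[/allP H _] u /H.
have [||L L0 LE] := IH b m' _ pD; first lra.
  by move=> u uD; apply: convex_function_chord => //; exact: aD.
exists ((m' - m, a) :: L).
  move=> w; rewrite inE => /predU1P[->|/L0 [w1 w2]] /=; first by split; lra.
  by split=> //; lra.
have Phib : Phi b = Phi a + m' * (b - a).
  by rewrite /m' divfK ?gt_eqF ?subr_gt0// addrC subrK.
move=> u; rewrite big_cons inE => /predU1P[->|uD].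
  rewrite subrr mulr0 addr0 big_seq big1 ?addr0 => [|w /L0 [_ aw]].
    by rewrite /hinge /pos_part subrr maxxx mulr0 addr0.
  by rewrite /hinge /pos_part max_r ?mulr0//; lra.
have au : a <= u by move: uD; rewrite inE => /predU1P[->|/aD ?]; lra.
have hau : hinge a u = u - a by rewrite /hinge /pos_part max_l ?subr_ge0.
rewrite LE// Phib [fst _]/= hau.
ring.
Qed.

Lemma hinge_expansion Phi D :
  {in [set u : R | 0 <= u] &, {homo Phi : u v / u <= v}} -> Phi 0 = 0 ->
  convex_function (E := R^o) [set u : R | 0 <= u] Phi ->
  {in D, forall u, 0 <= u} ->
  exists2 L : seq (R * R),
    {in L, forall w, 0 <= w.1 /\ 0 <= w.2} &
    {in D, forall u, Phi u = \sum_(w <- L) w.1 * hinge w.2 u}.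
Proof.
move=> incr Phi0 cvx D0.
pose D' := sort <=%R (undup [seq u <- D | 0 < u]).
have pD' : path <%R 0 D'.
  rewrite lt_path_sortedE sort_lt_sorted undup_uniq andbT.
  by apply/allP => u; rewrite mem_sort mem_undup mem_filter => /andP[].
have [|L L0 LE] := @hinge_expansion_from Phi 0 0 D' cvx (lexx _) pD'.
  move=> u; rewrite mem_sort mem_undup mem_filter => /andP[u0 _].
  rewrite subr0 Phi0 subr0; apply: divr_ge0; last exact: ltW.
  by rewrite -[leLHS]Phi0; apply: incr; rewrite ?inE /= ?lexx ?(ltW u0).
exists L => // u uD; rewrite LE ?Phi0 ?mul0r ?add0r//.
rewrite inE mem_sort mem_undup mem_filter uD andbT.
by rewrite eq_sym -le_eqVlt D0.
Qed.

End HingeExpansion.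

(** * Convexity of the aging cost and of the objective *)

Section Convexity.
Context {R : realType}.
Implicit Types (x y : seq R).

Definition mix (l : R) x y : seq R :=
  [seq l * p.1 + (1 - l) * p.2 | p <- zip x y].

Lemma pos_part_convex (l a b : R) : 0 <= l <= 1 ->
  pos_part (l * a + (1 - l) * b) <= l * pos_part a + (1 - l) * pos_part b.
Proof.
move=> /andP[l0 l1]; have m0 : 0 <= 1 - l by lra.
rewrite {1}/pos_part ge_max; apply/andP; split.
  by apply: lerD; rewrite ler_wpM2l// /pos_part le_max lexx.
by rewrite addr_ge0// mulr_ge0// /pos_part le_max lexx orbT.
Qed.

Lemma jump_convex (h l a b c d : R) : 0 <= l <= 1 ->
  jump h (l * a + (1 - l) * b) (l * c + (1 - l) * d) <=
  l * jump h a c + (1 - l) * jump h b d.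
Proof.
move=> l01; apply: le_trans (pos_part_convex _ _ l01).
rewrite /jump /hinge /pos_part ge_max !le_max lexx orbT andbT; apply/orP; left.
move/andP: l01 => [l0 l1]; have m0 : 0 <= 1 - l by lra.
have := ler_wpM2l l0 (ler_norm (a - c)); have := ler_wpM2l l0 (ler_norm (c - a)).
have := ler_wpM2l m0 (ler_norm (b - d)); have := ler_wpM2l m0 (ler_norm (d - b)).
rewrite (distrC c a) (distrC d b) => *.
by case: (ger0P (_ - _)) => _; lra.
Qed.

Lemma tv_convex (h l a b : R) x y : 0 <= l <= 1 -> size x = size y ->
  tv h (l * a + (1 - l) * b) (mix l x y) <= l * tv h a x + (1 - l) * tv h b y.
Proof.
move=> l01; have /andP[l0 l1] := l01; have m0 : 0 <= 1 - l by lra.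
elim: x y a b => [|c x IH] [|d y] a b //; first by rewrite /= !mulr0 addr0.
move=> [/IH {}IH].
rewrite tv_cons_le -/(mix l x y); apply/andP; split.
  by apply: le_trans (IH _ _) _; apply: lerD; rewrite ler_wpM2l// tv_cons_ge.
apply: (le_trans (lerD (jump_convex h a b c d l01) (IH c d))).
rewrite addrACA -!mulrDr.
by apply: lerD; rewrite ler_wpM2l// tv_step_ge.
Qed.

Lemma find_full_cycle_ge0 (s : seq R) u s' :
  find_full_cycle s = Some (u, s') -> 0 <= u.
Proof.
elim: s s' => // s0 [//|s1 [//|s2 [//|s3 t]]] IH s'.
rewrite find_full_cycle_cons; case: ifP => _; first by case=> <-.
by case E: (find_full_cycle _) => [[v t']|] // [vu _]; apply: (IH t'); rewrite E vu.
Qed.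

Lemma depths_ge0 x : {in depths x, forall u, 0 <= u}.
Proof.
have ext n s : {in (extract_full_cycles n s).1, forall u : R, 0 <= u}.
  elim: n s => // n IH s; rewrite extract_full_cyclesS.
  case E: (find_full_cycle s) => [[v s']|] //.
  have := IH s'; case: (extract_full_cycles n s') => us res H u.
  by rewrite inE => /predU1P[->|/H //]; exact: find_full_cycle_ge0 E.
move=> u; rewrite /depths /rainflow.
have := ext (size (local_extrema x)) (local_extrema x).
case: (extract_full_cycles _ _) => us res /= H.
by rewrite !mem_cat => /orP[] /orP[/H //|/mapP[p _ ->]].
Qed.

(** One hinge expansion serves the two profiles and their mixture, as it is
    chosen for all the depths of the three. *)
Lemma depths_sum_convex (Phi : R -> R) (l : R) x y :
  {in [set u : R | 0 <= u] &, {homo Phi : u v / u <= v}} -> Phi 0 = 0 ->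
  convex_function (E := R^o) [set u : R | 0 <= u] Phi ->
  0 <= l <= 1 -> size x = size y ->
  \sum_(u <- depths (mix l x y)) Phi u <=
  l * \sum_(u <- depths x) Phi u + (1 - l) * \sum_(u <- depths y) Phi u.
Proof.
move=> incr Phi0 cvx l01 sxy; have /andP[l0 l1] := l01.
pose D := depths (mix l x y) ++ depths x ++ depths y.
have memD u : (u \in D) =
    [|| u \in depths (mix l x y), u \in depths x | u \in depths y].
  by rewrite mem_cat (mem_cat u (depths x)).
have [|L L0 LE] := @hinge_expansion R Phi D incr Phi0 cvx.
  by move=> u; rewrite memD => /or3P[]; apply: depths_ge0.
have sumE z : {subset depths z <= D} -> \sum_(u <- depths z) Phi u =
    \sum_(w <- L) w.1 * \sum_(u <- depths z) hinge w.2 u.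
  move=> zD; under [RHS]eq_bigr do rewrite mulr_sumr.
  rewrite exchange_big /= big_seq [RHS]big_seq.
  by apply: eq_bigr => u /zD /LE.
rewrite !sumE; do ?by move=> u; rewrite memD => ->; rewrite ?orbT.
rewrite !mulr_sumr -big_split /= big_seq [leRHS]big_seq; apply: ler_sum => w wL.
have [w1 w2] := L0 _ wL.
rewrite !(mulrCA _ w.1) -mulrDr ler_wpM2l//.
case: x y sxy {D memD L L0 LE sumE wL} => [|a x] [|b y] //.
  by rewrite !big_nil !mulr0 addr0.
by move=> [sxy]; rewrite !rainflow_truncated_variation ?tv_convex.
Qed.

Lemma aging_costE (Phi : R -> R) (B E : R) x :
  aging_cost Phi B E x = B * E / 2 * \sum_(u <- depths x) Phi u.
Proof.
rewrite /aging_cost /depths; case: (rainflow x) => v w /=.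
rewrite -!mulr_suml big_cat /=; ring.
Qed.

Lemma scanl_mix (I : Type) (f g k : R -> I -> R) (l a b : R) (ts : seq I) :
  (forall a b t, k (l * a + (1 - l) * b) t = l * f a t + (1 - l) * g b t) ->
  scanl k (l * a + (1 - l) * b) ts = mix l (scanl f a ts) (scanl g b ts).
Proof.
move=> kE; elim: ts a b => //= t ts IH a b.
by rewrite /mix /= -/(mix l _ _) -IH kE.
Qed.

Lemma soc_profile_mix T (tau E eta_c eta_d x0 l : R) (c d c' d' : 'rV[R]_T) :
  soc_profile tau E eta_c eta_d x0
    (l *: c + (1 - l) *: c') (l *: d + (1 - l) *: d') =
  mix l (soc_profile tau E eta_c eta_d x0 c d)
        (soc_profile tau E eta_c eta_d x0 c' d').
Proof.
have x0E : x0 = l * x0 + (1 - l) * x0 by ring.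
rewrite /soc_profile {1}x0E.
by apply: scanl_mix => a b t; rewrite !mxE; ring.
Qed.

Lemma nth_mix (l : R) x y i : size x = size y ->
  (mix l x y)`_i = l * x`_i + (1 - l) * y`_i.
Proof.
move=> sxy; have [lt_i|le_i] := ltnP i (size x).
  by rewrite (nth_map (0, 0)) ?size_zip -?sxy ?minnn// nth_zip.
by rewrite !nth_default ?size_map ?size_zip -?sxy ?minnn// !mulr0 addr0.
Qed.

Lemma convex_itv (l m M a b : R) : 0 <= l <= 1 -> m <= a <= M -> m <= b <= M ->
  m <= l * a + (1 - l) * b <= M.
Proof.
move=> /andP[l0 l1] /andP[ma aM] /andP[mb bM]; apply/andP; split; nra.
Qed.

Lemma mismatch_penalty_convex T (tau eta_c eta_d theta pi l : R)
    (r c d c' d' : 'rV[R]_T) :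
  0 <= tau -> 0 <= theta -> 0 <= pi -> 0 <= l <= 1 ->
  mismatch_penalty tau eta_c eta_d theta pi r
    (l *: c + (1 - l) *: c') (l *: d + (1 - l) *: d') <=
  l * mismatch_penalty tau eta_c eta_d theta pi r c d +
  (1 - l) * mismatch_penalty tau eta_c eta_d theta pi r c' d'.
Proof.
move=> tau0 theta0 pi0 l01.
rewrite /mismatch_penalty !(mulrCA _ tau) -mulrDr ler_wpM2l// !mulr_sumr -big_split.
apply: ler_sum => t _ /=; rewrite !mxE.
set a := eta_c * c 0 t - d 0 t / eta_d - r 0 t.
set b := eta_c * c' 0 t - d' 0 t / eta_d - r 0 t.
have := pos_part_convex a b l01; have := pos_part_convex (- a) (- b) l01.
have -> : r 0 t - eta_c * c 0 t + d 0 t / eta_d = - a by rewrite /a; ring.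
have -> : r 0 t - eta_c * c' 0 t + d' 0 t / eta_d = - b by rewrite /b; ring.
have -> : eta_c * (l * c 0 t + (1 - l) * c' 0 t) -
  (l * d 0 t + (1 - l) * d' 0 t) / eta_d - r 0 t = l * a + (1 - l) * b.
  by rewrite /a /b; ring.
have -> : r 0 t - eta_c * (l * c 0 t + (1 - l) * c' 0 t) +
  (l * d 0 t + (1 - l) * d' 0 t) / eta_d = l * - a + (1 - l) * - b.
  by rewrite /a /b; ring.
move=> /(ler_wpM2l pi0) Hb /(ler_wpM2l theta0) Ha.
apply: (le_trans (lerD Ha Hb)).
by rewrite [leLHS](_ : _ = l * (theta * pos_part a + pi * pos_part (- a)) +
  (1 - l) * (theta * pos_part b + pi * pos_part (- b)))//; ring.
Qed.

End Convexity.

Theorem theorem1 (R : realType) (T : nat)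
    (tau E P B eta_c eta_d xmin xmax x0 theta pi : R)
    (Phi : R -> R) (r : 'rV[R]_T)
    (tau_gt0 : 0 < tau) (E_gt0 : 0 < E) (P_gt0 : 0 < P) (B_gt0 : 0 < B)
    (eta_c01 : 0 <= eta_c <= 1) (eta_d_ge1 : 1 <= eta_d)
    (xmin_lt_xmax : xmin < xmax) (theta_ge0 : 0 <= theta) (pi_ge0 : 0 <= pi)
    (r_bound : forall t : 'I_T, - P <= r 0 t <= P)
    (Phi_incr : {in [set u : R | 0 <= u] &, {homo Phi : u v / u <= v}})
    (Phi0 : Phi 0 = 0)
    (Phi_convex : convex_function (E := R^o) [set u : R | 0 <= u] Phi) :
  let S : set ('rV[R]_T * 'rV[R]_T) :=
    feasible tau E P eta_c eta_d x0 xmin xmax in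
  convex_set S /\
  convex_function S (objective Phi tau E B eta_c eta_d theta pi x0 r).
Proof.
have l01 (t : {i01 R}) : 0 <= t%:num <= 1 by rewrite ge0 le1.
move=> S; split=> [x y t|t x y _ _].
  rewrite !in_setE => Sx Sy i; have [socx cx dx] := Sx i; have [socy cy dy] := Sy i.
  rewrite -[(conv t x y).1]/(t%:num *: x.1 + (1 - t%:num) *: y.1).
  rewrite -[(conv t x y).2]/(t%:num *: x.2 + (1 - t%:num) *: y.2).
  rewrite soc_profile_mix nth_mix ?size_soc_profile// !mxE.
  by split; apply: convex_itv.
rewrite -[leRHS]/(t%:num * objective Phi tau E B eta_c eta_d theta pi x0 r x +
  (1 - t%:num) * objective Phi tau E B eta_c eta_d theta pi x0 r y).
rewrite /objective.
rewrite -[(conv t x y).1]/(t%:num *: x.1 + (1 - t%:num) *: y.1).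
rewrite -[(conv t x y).2]/(t%:num *: x.2 + (1 - t%:num) *: y.2).
rewrite soc_profile_mix 2!mulrDr addrACA; apply: lerD.
  exact: mismatch_penalty_convex (ltW tau_gt0) theta_ge0 pi_ge0 (l01 t).
rewrite !aging_costE !(mulrCA _ (B * E / 2)) -mulrDr ler_wpM2l//.
  by rewrite divr_ge0// mulr_ge0// ltW.
by apply: depths_sum_convex; rewrite ?size_soc_profile.
Qed.
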